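(* Let $P_{l1}, P_{h1}, P_{l2}, P_{h2} \in \mathbb{R}^D$ with $P_{l1} \le P_{h1}$ and $P_{l2} \le P_{h2}$. For $k = 1, 2$ consider the hypercube load $$\mathbf{P}_k = \left\{x \in \mathbb{R}^D \;\middle|\; \begin{bmatrix} \mathrm{I} \\ -\mathrm{I} \end{bmatrix} x \le \begin{bmatrix} P_{hk} \\ -P_{lk} \end{bmatrix}\right\}.$$ Then the outer Minkowski approximation to the Minkowski sum of $\mathbf{P}_1$ and $\mathbf{P}_2$ is exact, and is given by $$\begin{bmatrix} \mathrm{I} \\ -\mathrm{I} \end{bmatrix} x \le \begin{bmatrix} P_{h1} + P_{h2} \\ -(P_{l1} + P_{l2}) \end{bmatrix}.$$ That is, $\{x + y \mid x \in \mathbf{P}_1,\ y \in \mathbf{P}_2\}$ equals the set of all $x \in \mathbb{R}^D$ satisfying this system of inequalities.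
   Context: Vector inequalities are componentwise, and $\mathrm{I}$ is the $D \times D$ identity matrix. For two polytopes $\{x \mid A x \le b_1\}$ and $\{x \mid A x \le b_2\}$ in $\mathbb{R}^D$ described with the same matrix $A$, their outer Minkowski approximation is the polytope $\{z \mid A z \le b_1 + b_2\}$. It is called exact if it equals the Minkowski sum of the two polytopes. *)

(* Defs.v *)
From mathcomp Require Import all_boot all_order all_algebra.
From mathcomp Require Import all_classical all_reals.

Set Implicit Arguments.
Unset Strict Implicit.
Unset Printing Implicit Defensive.

Import Order.TTheory GRing.Theory Num.Theory.

Local Open Scope classical_set_scope.
Local Open Scope ring_scope.

Definition vle (R : realType) (n : nat) (u v : 'cV[R]_n) : Prop :=
  forall i : 'I_n, u i 0 <= v i 0.

(* Boundedness is not required here; it holds for the boxes below. *)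
Definition polytope (R : realType) (m n : nat) (A : 'M[R]_(m, n))
    (b : 'cV[R]_m) : set 'cV[R]_n :=
  [set x | vle (A *m x) b].

(* [`+`] on classical sets is the symmetric difference, not this sum. *)
Definition minkowski_sum (R : realType) (n : nat) (X Y : set 'cV[R]_n) :
    set 'cV[R]_n :=
  [set x + y | x in X & y in Y].

(* This depends on the descriptions (A, b1) and (A, b2), not only on the two
   sets: right-hand sides with redundant rows may give a larger polytope. *)
Definition outer_minkowski (R : realType) (m n : nat) (A : 'M[R]_(m, n))
    (b1 b2 : 'cV[R]_m) : set 'cV[R]_n :=
  polytope A (b1 + b2).

Definition outer_minkowski_exact (R : realType) (m n : nat)
    (A : 'M[R]_(m, n)) (b1 b2 : 'cV[R]_m) : Prop :=
  outer_minkowski A b1 b2 = minkowski_sum (polytope A b1) (polytope A b2).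

Definition box_mx (R : realType) (D : nat) : 'M[R]_(D + D, D) :=
  col_mx 1%:M (- 1%:M).

Definition box_rhs (R : realType) (D : nat) (l h : 'cV[R]_D) :
    'cV[R]_(D + D) :=
  col_mx h (- l).

Definition hypercube (R : realType) (D : nat) (l h : 'cV[R]_D) :
    set 'cV[R]_D :=
  polytope (box_mx R D) (box_rhs l h).

(* Main.v *)
Require Import Defs.
From mathcomp Require Import all_boot all_order all_algebra.
From mathcomp Require Import all_classical all_reals.
From mathcomp Require Import lra.

(** A box is a product of the intervals [l i, h i], so its Minkowski sum can be
    computed one coordinate at a time ([hypercubeP]), and for intervals
    [l1, h1] + [l2, h2] = [l1 + l2, h1 + h2].  Adding the inequalities gives
    the inclusion from left to right.  Conversely, a point z of the right-hand
    interval is split greedily ([interval_split]): the first summand is as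
    large as it can be while leaving at least l2 for the second.  The
    right-hand sides of the inequality systems add up row by row, so the outer
    approximation is the box on the right, hence equal to the sum. *)

Import Order.TTheory GRing.Theory Num.Theory.

Local Open Scope classical_set_scope.
Local Open Scope ring_scope.

Lemma hypercubeP (R : realType) (D : nat) (l h x : 'cV[R]_D) :
  hypercube l h x <-> forall i, l i 0 <= x i 0 <= h i 0.
Proof.
rewrite /hypercube /polytope /box_mx /box_rhs /= mul_col_mx mul1mx mulNmx mul1mx.
split=> [lxh i|lxh i].
  have := lxh (lshift D i); have := lxh (rshift D i).
  by rewrite !col_mxEd !col_mxEu !mxE lerN2 => -> ->.
case: (split_ordP i) => j ->; have /andP[lx xh] := lxh j.
  by rewrite !col_mxEu.
by rewrite !col_mxEd !mxE lerN2.
Qed.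

Lemma box_rhsD (R : realType) (D : nat) (l1 h1 l2 h2 : 'cV[R]_D) :
  box_rhs l1 h1 + box_rhs l2 h2 = box_rhs (l1 + l2) (h1 + h2).
Proof. by rewrite /box_rhs add_col_mx opprD. Qed.

(** Taking a minimum gives x <= h1 and l2 <= z - x at once.  The other two
    bounds hold for either value of the minimum: if x = h1 they read l1 <= h1
    and z <= h1 + h2, and if x = z - l2 they read l1 + l2 <= z and l2 <= h2. *)
Lemma interval_split (R : realDomainType) (l1 h1 l2 h2 z : R) :
  l1 <= h1 -> l2 <= h2 -> l1 + l2 <= z <= h1 + h2 ->
  let x := Num.min h1 (z - l2) in (l1 <= x <= h1) && (l2 <= z - x <= h2).
Proof.
move=> le1 le2 /andP[lz zh] /=.
by case: (leP h1 (z - l2)) => cmp; repeat (apply/andP; split); lra.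
Qed.

Lemma minkowski_sum_hypercube (R : realType) (D : nat)
    (l1 h1 l2 h2 : 'cV[R]_D) (le1 : vle l1 h1) (le2 : vle l2 h2) :
  minkowski_sum (hypercube l1 h1) (hypercube l2 h2) =
    hypercube (l1 + l2) (h1 + h2).
Proof.
apply/seteqP; split=> [_ [x /hypercubeP Hx [y /hypercubeP Hy <-]]|z /hypercubeP Hz].
  apply/hypercubeP => i; have /andP[? ?] := Hx i; have /andP[? ?] := Hy i.
  by rewrite !mxE !lerD.
pose x : 'cV[R]_D := \col_i Num.min (h1 i 0) (z i 0 - l2 i 0).
have Hs i : (l1 i 0 <= x i 0 <= h1 i 0) && (l2 i 0 <= z i 0 - x i 0 <= h2 i 0).
  rewrite mxE; apply: interval_split; [exact: le1 | exact: le2 |].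
  by have := Hz i; rewrite !mxE.
exists x; first by apply/hypercubeP => i; have /andP[] := Hs i.
exists (z - x); last by rewrite addrC subrK.
by apply/hypercubeP => i; have /andP[_] := Hs i; rewrite !mxE.
Qed.

Theorem proposition2 (R : realType) (D : nat) (Pl1 Ph1 Pl2 Ph2 : 'cV[R]_D)
    (h1 : vle Pl1 Ph1) (h2 : vle Pl2 Ph2) :
  [/\ outer_minkowski_exact (box_mx R D) (box_rhs Pl1 Ph1) (box_rhs Pl2 Ph2),
      outer_minkowski (box_mx R D) (box_rhs Pl1 Ph1) (box_rhs Pl2 Ph2) =
        [set x | vle (box_mx R D *m x)
                     (col_mx (Ph1 + Ph2) (- (Pl1 + Pl2)))] &
      minkowski_sum (hypercube Pl1 Ph1) (hypercube Pl2 Ph2) =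
        [set x | vle (box_mx R D *m x)
                     (col_mx (Ph1 + Ph2) (- (Pl1 + Pl2)))] ].
Proof.
have sumE := minkowski_sum_hypercube _ _ _ _ _ _ h1 h2.
have outerE : outer_minkowski (box_mx R D) (box_rhs Pl1 Ph1) (box_rhs Pl2 Ph2) =
    hypercube (Pl1 + Pl2) (Ph1 + Ph2) by rewrite /outer_minkowski box_rhsD.
by split; [rewrite /outer_minkowski_exact outerE -sumE | exact: outerE | exact: sumE].
Qed.
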